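(* Let $1<p<\infty$ and let $(\Omega,\mu)$ be a measure space. Then the following sets of measurable functions on $\Omega$ coincide: (a) $L(p,\infty)(\Omega)=\{f\in L^1_{loc}(\Omega):\ \|f\|^{*}_{L(p,\infty)}:=\sup_{s>0}\{f^*(s)s^{1/p}\}<\infty\}$; (b) $\{f\in L^1_{loc}(\Omega):\ \|f\|_{L(p,\infty)}:=\sup_{s>0}\{f^{**}(s)s^{1/p}\}<\infty\}$; (c) the set of all $f$ such that $f^{**}(\infty)=0$ and $\|f\|^{\#}_{L(p,\infty)}:=\sup_{s>0}\{(f^{**}(s)-f^*(s))s^{1/p}\}<\infty$; (d) the set of all $f$ such that $f^{**}(\infty)=0$ and $$\|f\|^{\#\#}_{L(p,\infty)}:=\sup_{t>0}\left\{\frac{1}{(\lambda_f(t))^{1-1/p}}\int_t^\infty\lambda_f(s)\,ds\right\}<\infty.$$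
   Context: Functions are measurable, scalar-valued, finite a.e. For such $f$ on $(\Omega,\mu)$: $\lambda_f(s)=\mu(\{x\in\Omega:|f(x)|>s\})$ for $s\ge0$ is the distribution function; $f^*(t)=\inf\{s\ge0:\lambda_f(s)\le t\}$, $t>0$, is the non-increasing rearrangement; $f^{**}(t)=\frac1t\int_0^tf^*(s)\,ds$; and $f^{**}(\infty)=\lim_{t\to\infty}f^{**}(t)$. $L^1_{loc}(\Omega)$ denotes the measurable functions integrable over every set of finite measure. In (d), the quotient is taken to be $0$ for those $t$ with $\lambda_f(t)=0$ (the integral also vanishes then); $f^{**}(\infty)=0$ guarantees $\lambda_f(t)<\infty$ for all $t>0$. *)

(* Defs.v *)
From HB Require Import structures.
From mathcomp Require Import all_boot all_order all_algebra.
From mathcomp Require Import all_classical all_reals all_analysis.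
From mathcomp Require Import measurable_realfun complex.

Set Implicit Arguments.
Unset Strict Implicit.
Unset Printing Implicit Defensive.

Import Order.TTheory GRing.Theory Num.Theory.
Import numFieldNormedType.Exports.

Local Open Scope classical_set_scope.
Local Open Scope ring_scope.
Local Open Scope ereal_scope.

(* "Scalar-valued" covers real and complex functions. Real functions that are
   finite almost everywhere take their values in \bar R; a complex function is
   finite everywhere. *)
Variant scalar_kind := RealScalars | ComplexScalars.

Definition scalar_type (R : realType) (K : scalar_kind) : Type :=
  match K with
  | RealScalars => \bar R
  | ComplexScalars => complex R
  end.

Definition modulus (R : realType) (K : scalar_kind) : scalar_type R K -> \bar R :=
  match K return scalar_type R K -> \bar R with
  | RealScalars => fun z : \bar R => `|z|
  | ComplexScalars => fun z : complex R => (ComplexField.Normc.normc z)%:E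
  end.

(* Borel measurability of a complex function is that of its two coordinates. *)
Definition measurable_scalar (R : realType) (K : scalar_kind)
    (d : measure_display) (T : measurableType d) :
    (T -> scalar_type R K) -> Prop :=
  match K return (T -> scalar_type R K) -> Prop with
  | RealScalars => fun f : T -> \bar R => measurable_fun [set: T] f
  | ComplexScalars => fun f : T -> complex R =>
      measurable_fun [set: T] (fun x => complex.Re (f x)) /\
      measurable_fun [set: T] (fun x => complex.Im (f x))
  end.

Section rearrangement.
Context (R : realType) (d : measure_display) (T : measurableType d).
Variables (mu : {measure set T -> \bar R}) (K : scalar_kind).
Implicit Types (f : T -> scalar_type R K) (s t p : R).

Definition ae_finite_functions : set (T -> scalar_type R K) :=
  [set f | @measurable_scalar R K d T f /\ {ae mu, forall x, modulus (f x) < +oo}].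

Definition L1loc : set (T -> scalar_type R K) :=
  [set f | ae_finite_functions f /\
    forall A : set T, measurable A -> mu A < +oo ->
      \int[mu]_(x in A) modulus (f x) < +oo].

Definition distribution_function f s : \bar R :=
  mu [set x | s%:E < modulus (f x)].

(* The rearrangement f*. The infimum of the empty set is +oo. *)
Definition rearrangement f t : \bar R :=
  ereal_inf [set s%:E | s in
    [set s : R | (0 <= s)%R /\ distribution_function f s <= t%:E]].

(* The average f** of the rearrangement. *)
Definition maximal_rearrangement f t : \bar R :=
  (t^-1)%:E * \int[lebesgue_measure]_(s in `]0%R, t[) rearrangement f s.

(* f**(oo) = 0, where f**(oo) is the limit of f** at +oo,
   which always exists in \bar R because f** is non-increasing. *)
Definition vanishing_at_infinity f : Prop :=
  maximal_rearrangement f t @[t --> +oo%R] --> (0 : \bar R).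

Definition weakL_norm_star p f : \bar R :=
  ereal_sup [set rearrangement f s * (s `^ p^-1)%:E | s in [set s : R | (0 < s)%R]].

Definition weakL_norm p f : \bar R :=
  ereal_sup [set maximal_rearrangement f s * (s `^ p^-1)%:E
            | s in [set s : R | (0 < s)%R]].

(* The difference is used only when f**(oo) = 0, in which case both
   terms are finite, so the convention +oo - +oo = -oo plays no role. *)
Definition weakL_norm_sharp p f : \bar R :=
  ereal_sup [set (maximal_rearrangement f s - rearrangement f s) *
                   (s `^ p^-1)%:E
            | s in [set s : R | (0 < s)%R]].

(* The library inverse sends 0 to +oo, hence the case distinction. A vanishing
   f**(oo) makes the distribution function finite at every t > 0. *)
Definition tail_quotient p f t : \bar R :=
  if distribution_function f t == 0 then 0
  else (distribution_function f t `^ (1 - p^-1)%R)^-1 *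
       \int[lebesgue_measure]_(s in `]t, +oo[) distribution_function f s.

Definition weakL_norm_sharp2 p f : \bar R :=
  ereal_sup [set tail_quotient p f t | t in [set t : R | (0 < t)%R]].

Definition weakL p : set (T -> scalar_type R K) :=
  [set f | L1loc f /\ weakL_norm_star p f < +oo].

Definition weakL_maximal p : set (T -> scalar_type R K) :=
  [set f | L1loc f /\ weakL_norm p f < +oo].

Definition weakL_sharp p : set (T -> scalar_type R K) :=
  [set f | [/\ ae_finite_functions f, vanishing_at_infinity f &
               weakL_norm_sharp p f < +oo]].

Definition weakL_sharp2 p : set (T -> scalar_type R K) :=
  [set f | [/\ ae_finite_functions f, vanishing_at_infinity f &
               weakL_norm_sharp2 p f < +oo]].

End rearrangement.

Arguments weakL {R d T} mu K p.
Arguments weakL_maximal {R d T} mu K p.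
Arguments weakL_sharp {R d T} mu K p.
Arguments weakL_sharp2 {R d T} mu K p.

(* Main.v *)
Require Import Defs.
From mathcomp Require Import all_boot all_order all_algebra.
From mathcomp Require Import all_classical all_reals all_analysis.
From mathcomp Require Import measurable_realfun complex ring lra.

(** Write lam for the distribution function of f, f* for its rearrangement and
    f** for the average of f*.

    The link between the quantities is the area identity
    [integral_rearrangement]: for t >= 0,
      integral of f* over (0, t) = integral over s > 0 of min(t, lam s).
    It is the layer-cake formula (Tonelli's theorem) for f* on (0, t), once
    one knows that f* t <= s iff lam s <= t for s >= 0, which is the right
    continuity of lam. Bounding or computing the minimum on both sides of a
    level b gives
      t f** t <= t b + (integral of lam over (b, oo)),
    with equality when lam b = t. The layer-cake formula for f on a set A of
    finite measure also shows that the integral of |f| over A is at most the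
    integral of f* over (0, mu A), so f**(oo) = 0 implies local integrability.

    - (a) and (b). Since f* <= f**, (b) implies (a). Conversely
      f* t <= C t^(-1/p) means lam s <= (C / s)^p, and the area inequality at
      b = C t^(-1/p) bounds f** t by a multiple of t^(-1/p).
    - (b) and (c). The bound on f** forces f**(oo) = 0 and dominates f** - f*.
      Conversely, since f* is non-increasing, 2 f**(2t) >= f** t + f*(2t), so
      f** t <= f**(2t) + C (2t)^(-1/p). Iterating sums a geometric series of
      ratio 2^(-1/p), and the term f**(2^n t) tends to 0.
    - (c) and (d). For r = lam s > 0, f* r <= s and the area equality give
      (integral of lam over (s, oo)) = r (f** r - s) <= r (f** r - f* r).
      Conversely, if b > f* t then lam b <= t, so (d) bounds the integral of
      lam over (b, oo) by C t^(1 - 1/p); the area inequality then gives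
      f** t <= b + C t^(-1/p), and b decreases to f* t. *)

Set Implicit Arguments.
Unset Strict Implicit.

Import Order.TTheory GRing.Theory Num.Theory.
Import numFieldNormedType.Exports.

Local Open Scope classical_set_scope.
Local Open Scope ring_scope.

(** * The layer-cake formula *)

Section layer_cake.
Local Open Scope ereal_scope.

(** The finiteness of [mu D] is what makes Tonelli's theorem applicable: [mu]
    itself need not be sigma-finite. *)
Lemma layer_cake (R : realType) (d : measure_display) (T : measurableType d)
    (mu : {measure set T -> \bar R}) (D : set T) (g : T -> \bar R) :
  measurable D -> mu D < +oo -> measurable_fun [set: T] g ->
  (forall x, 0 <= g x) ->
  \int[mu]_(x in D) g x =
  \int[lebesgue_measure]_(s in `]0%R, +oo[) mu (D `&` [set x | s%:E < g x]).
Proof.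
move=> mD muD mg g0.
pose m := mfrestr mD muD.
pose E : set (T * R) :=
  (D `*` `]0%R, +oo[%classic) `&` [set z | (z.2)%:E < g z.1].
have mE : measurable E.
  apply: measurableI; first exact: measurableX.
  rewrite -[X in measurable X]setTI; apply: measurable_lte => //.
  - by apply/measurable_EFinP; exact: measurable_snd.
  - exact: (measurableT_comp mg measurable_fst).
transitivity (\int[m]_(x in D) g x).
  apply: eq_measure_integral => A mA AD.
  by rewrite /= /mfrestr /mrestr setIidl.
(* [E] is the region below the graph of [g] over [D]; its sections are the
   intervals (0, g x) and the superlevel sets of [g]. *)
have tonelli := @indic_fubini_tonelli _ _ _ _ R m lebesgue_measure E mE.
transitivity (\int[m]_x fubini_F lebesgue_measure (EFin \o \1_E) x).
  rewrite [LHS]integral_mkcond; apply: eq_integral => x _.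
  rewrite indic_fubini_tonelli_FE//= patchE.
  have [xD|xD] := ifPn.
    rewrite (_ : xsection E x = [set` Interval (BRight 0%R)
        (if g x is r%:E then BLeft r else +oo%O)]).
      rewrite lebesgue_measure_itv/=.
      case: (g x) (g0 x) => [r| |] //= r0; rewrite ?lte_fin ?ltry ?sube0//.
      by case: ltP => // r0'; congr _%:E; apply/le_anti/andP; split.
    apply/seteqP; split => s; rewrite xsectionE/= in_itv/=.
      move=> [[/= _]]; rewrite in_itv/= andbT => -> sg/=.
      by case: (g x) sg.
    move=> /andP[s0 sg]; split; first by split; [exact/set_mem|rewrite /= in_itv/= s0].
    by rewrite /=; move: sg (g0 x); case: (g x) => //= *; rewrite ltry.
  rewrite [X in lebesgue_measure X](_ : _ = set0) ?measure0//.
  apply/seteqP; split => // s; rewrite xsectionE/= => -[[/= xD' _] _].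
  by move/negP: xD; apply; exact/mem_set.
rewrite tonelli [RHS]integral_mkcond; apply: eq_integral => s _.
rewrite indic_fubini_tonelli_GE//= patchE /m /mfrestr /mrestr/=.
have [|] := ifPn; rewrite (inE, notin_setE)/= in_itv/= andbT => s0.
  congr (mu _); apply/seteqP; split => x; rewrite ysectionE/=.
    by move=> [[[/=]]].
  by move=> [xD sg]; split=> //; split=> //=; rewrite in_itv/= s0.
rewrite (_ : _ `&` _ = set0) ?measure0//; apply/seteqP; split => // x.
by rewrite ysectionE/= => -[[[/= _]]]; rewrite in_itv/= andbT => /s0.
Qed.

End layer_cake.

(** * Powers of a real variable *)

Section power.
Context {R : realType}.
Implicit Types p q a : R.

Lemma powRVl a q : 0 <= a -> a^-1 `^ q = (a `^ q)^-1.
Proof. by move=> a0; rewrite -!powR_inv1 ?powR_ge0// powRAC. Qed.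

Lemma powRN_cvgy0 q : 0 < q -> x `^ (- q) @[x --> +oo] --> (0 : R).
Proof.
move=> q0; apply/cvgr0Pnorm_le => e e0.
near=> x.
have x0 : 0 < x by near: x; exact: nbhs_pinfty_gt.
have ex : e `^ (- q^-1) <= x by near: x; exact: nbhs_pinfty_ge.
rewrite ger0_norm ?powR_ge0// powRN -[leRHS]invrK lef_pV2 ?posrE ?powR_gt0 ?invr_gt0//.
have -> : e^-1 = (e `^ (- q^-1)) `^ q.
  by rewrite -powRrM mulNr mulVf ?gt_eqF// powR_inv1// ltW.
by apply: ge0_ler_powR => //; rewrite ?nnegrE ?powR_ge0 ?ltW.
Unshelve. all: by end_near. Qed.

Lemma integral_powR_tail p a : 1 < p -> 0 < a ->
  (\int[lebesgue_measure]_(s in `]a, +oo[) (s `^ (- p))%:E =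
   (a `^ (1 - p) / (p - 1))%:E)%E.
Proof.
move=> p1 a0; have p10 : 0 < p - 1 by rewrite subr_gt0.
pose F : R -> R := (- (p - 1)^-1) \*: (@powR R ^~ (1 - p)).
have dF (x : R) : 0 < x -> is_derive x (1 : R) F (x `^ (- p)).
  move=> x0; apply: is_derive_eq.
    by apply: is_deriveZ; exact: is_derive1_powR.
  rewrite /GRing.scale/= mulrA (_ : 1 - p - 1 = - p); last by ring.
  by rewrite (_ : _ * (1 - p) = 1) ?mul1r//; field; rewrite gt_eqF.
have cf (x : R) : 0 < x -> {for x, continuous (fun s : R => s `^ (- p))}.
  move=> x0; apply: differentiable_continuous; apply/derivable1_diffP.
  by apply: derivable_powR; rewrite in_itv/= x0.
rewrite integral_itv_obnd_cbnd; last first.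
  by apply/measurable_EFinP; apply: measurable_funTS; exact: measurable_powR.
rewrite (@ge0_continuous_FTC2y _ _ F a 0).
- by rewrite sub0e -EFinN; congr _%:E; rewrite /F/= /GRing.scale/= mulNr opprK mulrC.
- by move=> x _; exact: powR_ge0.
- apply/continuous_within_itvcyP; split.
    by move=> x; rewrite in_itv/= andbT => ax; apply: cf; exact: lt_trans ax.
  by apply: cvg_at_right_filter; exact: cf.
- rewrite -[X in _ --> X](mulr0 (- (p - 1)^-1)); apply: cvgM; first exact: cvg_cst.
  by rewrite -opprB; exact: powRN_cvgy0.
- by move=> x ax; have := dF x (lt_trans a0 ax); case.
- apply: cvg_at_right_filter; apply: differentiable_continuous.
  by apply/derivable1_diffP; have := dF a a0; case.
- move=> x; rewrite in_itv/= andbT => ax; rewrite derive1E.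
  by have [_ ->] := dF x (lt_trans a0 ax).
Qed.

End power.

(** * Distribution function and rearrangement *)

Lemma nonincreasing_emeasurable (R : realType) (h : R -> \bar R) :
  {homo h : x y / (x <= y)%R >-> (y <= x)%E} -> measurable_fun [set: R] h.
Proof.
move=> hni; apply: (measurability _ (ErealGenOInfty.measurableE R)).
move=> _ [_ [x ->] <-]; rewrite setTI.
apply: is_interval_measurable => a b /=; rewrite !in_itv/= !andbT => ha hb c.
by move=> /andP[ac cb]; rewrite in_itv/= andbT (lt_le_trans hb)// hni.
Qed.

Section rearrangement_theory.
Local Open Scope ereal_scope.
Context {R : realType} {d : measure_display} {T : measurableType d}.
Context {mu : {measure set T -> \bar R}} {K : scalar_kind}.
Implicit Types (f : T -> scalar_type R K) (s t : R).

Local Notation leb := (@lebesgue_measure R).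
Local Notation lam := (distribution_function mu).
Local Notation rear := (rearrangement mu).

Lemma modulus_ge0 (z : scalar_type R K) : 0 <= modulus z.
Proof.
by case: K z => [z|[a b]] /=; [exact: abse_ge0|rewrite lee_fin sqrtr_ge0].
Qed.

Lemma measurable_modulus f : measurable_scalar f ->
  measurable_fun [set: T] (fun x => modulus (f x)).
Proof.
case: K f => f /=; first by move=> mf; exact: measurableT_comp.
move=> [mRe mIm]; apply/measurable_EFinP.
rewrite (_ : (fun x => _) = (@Num.sqrt R) \o
    (fun x => complex.Re (f x) ^+ 2 + complex.Im (f x) ^+ 2)%R); last first.
  by apply/funext => x /=; case: (f x).
apply: measurableT_comp.
  by apply: continuous_measurable_fun; exact: sqrt_continuous.
by apply: measurable_funD; exact: measurable_funX.
Qed.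

Lemma distribution_ge0 f s : 0 <= lam f s.
Proof. exact: measure_ge0. Qed.

Lemma measurable_superlevel f s : measurable_scalar f ->
  measurable [set x | s%:E < modulus (f x)].
Proof.
move=> /measurable_modulus mf; rewrite -[X in measurable X]setTI.
by apply: measurable_lte.
Qed.

Lemma distribution_nonincreasing f : measurable_scalar f ->
  {homo lam f : s t / (s <= t)%R >-> t <= s}.
Proof.
move=> mf s t st; apply: le_measure; rewrite ?inE.
- exact: measurable_superlevel.
- exact: measurable_superlevel.
- by move=> x /= tx; rewrite (le_lt_trans _ tx)// lee_fin.
Qed.

Lemma measurable_distribution f : measurable_scalar f ->
  measurable_fun [set: R] (lam f).
Proof.
by move=> mf; apply: nonincreasing_emeasurable; exact: distribution_nonincreasing.
Qed.

(** Right continuity of the distribution function, in the form needed for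
    [rearrangement_leE]. *)
Lemma distribution_right_continuous f s y : measurable_scalar f ->
  (forall s', (s < s')%R -> lam f s' <= y) -> lam f s <= y.
Proof.
move=> mf Hy; pose F n := [set x | (s + n.+1%:R^-1)%:E < modulus (f x)].
have FE : [set x | s%:E < modulus (f x)] = \bigcup_n F n.
  apply/seteqP; split => x /=; last first.
    by move=> [n _]; apply: lt_trans; rewrite lte_fin ltrDl invr_gt0.
  case E : (modulus (f x)) => [r| |] //.
    rewrite lte_fin => sr.
    have [n] := ltr_add_invr sr.
    by exists n => //; rewrite /F/= E lte_fin.
  by exists 0%N => //; rewrite /F/= E ltry.
have cF : mu (F n) @[n --> \oo] --> lam f s.
  rewrite /distribution_function FE; apply: nondecreasing_cvg_mu.
  - by move=> n; exact: measurable_superlevel.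
  - by apply: bigcupT_measurable => n; exact: measurable_superlevel.
  - move=> m n mn; apply/subsetPset => x; rewrite /F /=; apply: le_lt_trans.
    by rewrite lee_fin lerD2l lef_pV2 ?posrE// ler_nat.
rewrite -(cvg_lim _ cF)//; apply: lime_le; first by apply/cvg_ex; exists (lam f s).
by apply: nearW => n; apply: Hy; rewrite ltrDl invr_gt0.
Qed.

Lemma rearrangement_ge0 f t : 0 <= rear f t.
Proof. by apply: le_ereal_inf_tmp => _ [s [s0 _] <-]; rewrite lee_fin. Qed.

(** The Galois connection between the distribution function and the
    rearrangement; right continuity makes it hold for non-strict
    inequalities. *)
Lemma rearrangement_leE f s t : measurable_scalar f -> (0 <= s)%R ->
  (rear f t <= s%:E) = (lam f s <= t%:E).
Proof.
move=> mf s0; apply/idP/idP => [H|H]; last by apply: ereal_inf_lbound; exists s.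
apply: distribution_right_continuous => // s' ss'.
have /ereal_inf_lt[_ [u [u0 lu] <-]] : rear f t < s'%:E.
  by rewrite (le_lt_trans H)// lte_fin.
rewrite lte_fin => us'; rewrite (le_trans _ lu)//.
by apply: distribution_nonincreasing => //; exact: ltW.
Qed.

Lemma rearrangement_nonincreasing f : {homo rear f : s t / (s <= t)%R >-> t <= s}.
Proof.
move=> s t st; apply: ereal_inf_le_tmp => _ [u [u0 lu] <-]; exists u => //.
by split=> //; rewrite (le_trans lu)// lee_fin.
Qed.

Lemma measurable_rearrangement f : measurable_fun [set: R] (rear f).
Proof.
by apply: nonincreasing_emeasurable; exact: rearrangement_nonincreasing.
Qed.

End rearrangement_theory.

(** * The area under the rearrangement *)

Section area.
Local Open Scope ereal_scope.
Context {R : realType} {d : measure_display} {T : measurableType d}.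
Context {mu : {measure set T -> \bar R}} {K : scalar_kind}.
Implicit Types (f : T -> scalar_type R K) (s t : R).

Local Notation leb := (@lebesgue_measure R).
Local Notation lam := (distribution_function mu).
Local Notation rear := (rearrangement mu).

Lemma measurable_mine_distribution f (D : set R) (y : \bar R) : measurable_scalar f ->
  measurable_fun D (fun s => mine y (lam f s)).
Proof.
move=> mf; apply: measurable_mine; first exact: measurable_cst.
by apply: measurable_funTS; exact: measurable_distribution.
Qed.

(** Area identity for the rearrangement. *)
Lemma integral_rearrangement f t : measurable_scalar f -> (0 <= t)%R ->
  \int[leb]_(s in `]0%R, t[) rear f s =
  \int[leb]_(s in `]0%R, +oo[) mine t%:E (lam f s).
Proof.
move=> mf t0.
rewrite (@layer_cake R _ _ leb); last 4 first.
- exact: measurable_itv.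
- by rewrite /= lebesgue_measure_itv/=; case: ifPn => // _; rewrite -EFinB ltry.
- exact: measurable_rearrangement.
- by move=> x; exact: rearrangement_ge0.
apply: eq_integral => s; rewrite inE/= in_itv/= andbT => s0.
have l0 := @distribution_ge0 _ _ _ mu _ f s.
(* By [rearrangement_leE], s < f* u iff u < lam s, so the superlevel set of f*
   in (0, t) is the interval (0, min(t, lam s)). *)
rewrite (_ : _ `&` _ = [set` Interval (BRight 0%R)
    (if lam f s is r%:E then BLeft (Num.min t r) else BLeft t)]).
  rewrite lebesgue_measure_itv/=.
  case: (lam f s) l0 => [r| |]//=; rewrite ?lee_fin => r0.
    rewrite -EFin_min lte_fin sube0.
    case: ltP => // r0'; congr _%:E; apply/le_anti; rewrite r0'.
    by rewrite le_min t0 r0.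
  by rewrite miney lte_fin sube0; case: ltP => // t0'; congr _%:E; apply/le_anti/andP.
apply/seteqP; split => u; rewrite /= !in_itv/= [(s%:E < _)%E]ltNge
  rearrangement_leE ?(ltW s0)//.
  rewrite -ltNge => -[/andP[-> ut]] /=; move: l0.
  by case: (lam f s) => [r| |]//= _; rewrite lte_fin lt_min ut.
rewrite -ltNge; move: l0; case: (lam f s) => [r| |]//= _.
  by rewrite lt_min lte_fin => /and3P[-> -> ->].
by move=> ->; rewrite ltry.
Qed.

Lemma integral_mine_distribution_split f t b : measurable_scalar f ->
  (0 <= t)%R -> (0 <= b)%R ->
  \int[leb]_(s in `]0%R, +oo[) mine t%:E (lam f s) =
  \int[leb]_(s in `]0%R, b]) mine t%:E (lam f s) +
  \int[leb]_(s in `]b, +oo[) mine t%:E (lam f s).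
Proof.
move=> mf t0 b0.
rewrite (_ : `]0%R, +oo[%classic = `]0%R, b] `|` `]b, +oo[); last first.
  by rewrite -itv_bndbnd_setU// ?bnd_simp.
rewrite ge0_integral_setU//=.
- exact: measurable_mine_distribution.
- by move=> s _; rewrite le_min lee_fin t0 distribution_ge0.
- apply/disj_setPLR => s /=; rewrite !in_itv/= andbT => /andP[_ sb].
  by apply/negP; rewrite -leNgt.
Qed.

Lemma integral_cst_itv0b t b : (0 <= b)%R ->
  \int[leb]_(s in `]0%R, b]) t%:E = (t * b)%:E.
Proof.
move=> b0; rewrite integral_cst//= lebesgue_measure_itv/= lte_fin.
case: ltP => [_|b0']; first by rewrite sube0 -EFinM.
by rewrite mule0 (_ : b = 0%R) ?mulr0//; apply/le_anti/andP.
Qed.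

Lemma integral_rearrangement_le f t b : measurable_scalar f ->
  (0 <= t)%R -> (0 <= b)%R ->
  \int[leb]_(s in `]0%R, t[) rear f s <=
  (t * b)%:E + \int[leb]_(s in `]b, +oo[) lam f s.
Proof.
move=> mf t0 b0.
rewrite integral_rearrangement// (@integral_mine_distribution_split _ _ b)//.
rewrite -integral_cst_itv0b//; apply: leeD; apply: ge0_le_integral => //=.
- by move=> s _; rewrite le_min lee_fin t0 distribution_ge0.
- exact: measurable_mine_distribution.
- by move=> s _; rewrite ge_min lexx.
- by move=> s _; rewrite le_min lee_fin t0 distribution_ge0.
- exact: measurable_mine_distribution.
- by apply: measurable_funTS; exact: measurable_distribution.
- by move=> s _; rewrite ge_min lexx orbT.
Qed.

(** At a level [b] with lam b = t, the minimum of [t] and lam is [t] to the left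
    of [b] and lam to the right. *)
Lemma integral_rearrangement_eq f t b : measurable_scalar f -> (0 <= b)%R ->
  lam f b = t%:E ->
  \int[leb]_(s in `]0%R, t[) rear f s =
  (t * b)%:E + \int[leb]_(s in `]b, +oo[) lam f s.
Proof.
move=> mf b0 bt; have t0 : (0 <= t)%R by rewrite -lee_fin -bt distribution_ge0.
rewrite integral_rearrangement// (@integral_mine_distribution_split _ _ b)//.
rewrite -integral_cst_itv0b//; congr (_ + _).
  apply: eq_integral => s; rewrite inE/= in_itv/= => /andP[_ sb].
  by rewrite min_l// -bt distribution_nonincreasing.
apply: eq_integral => s; rewrite inE/= in_itv/= andbT => /ltW bs.
by rewrite min_r// -bt distribution_nonincreasing.
Qed.

(** The Hardy-Littlewood inequality for the modulus of f and the indicator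
    function of A. *)
Lemma integral_modulus_le f (A : set T) : measurable_scalar f ->
  measurable A -> mu A < +oo ->
  \int[mu]_(x in A) modulus (f x) <=
  \int[leb]_(s in `]0%R, fine (mu A)[) rear f s.
Proof.
move=> mf mA muA; have muAfin : (fine (mu A))%:E = mu A.
  by rewrite fineK// ge0_fin_numE.
rewrite integral_rearrangement ?fine_ge0// layer_cake//; last 2 first.
- exact: measurable_modulus.
- by move=> x; exact: modulus_ge0.
apply: ge0_le_integral => //=.
- apply: measurable_funTS; apply: nonincreasing_emeasurable => s t st.
  apply: le_measure; rewrite ?inE.
  + by apply: measurableI => //; exact: measurable_superlevel.
  + by apply: measurableI => //; exact: measurable_superlevel.
  + by apply: setIS => x /= tx; rewrite (le_lt_trans _ tx)// lee_fin.
- exact: measurable_mine_distribution.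
move=> s _; rewrite le_min muAfin; apply/andP; split.
  by apply: measureIl => //; exact: measurable_superlevel.
by apply: measureIr => //; exact: measurable_superlevel.
Qed.

End area.

(** * Averages of the rearrangement and the four conditions *)

(** A supremum of extended reals is less than +oo iff the family has a positive
    real bound. The family may be empty or take the value -oo. *)
Lemma ereal_sup_ltyP (R : realType) (h : R -> \bar R) (P : set R) :
  (ereal_sup [set h s | s in P] < +oo)%E <->
  exists2 C : R, 0 < C & forall s, P s -> (h s <= C%:E)%E.
Proof.
split=> [supy|[C C0 hC]]; last first.
  apply: le_lt_trans (ltry C); apply: ge_ereal_sup => _ [s Ps <-]; exact: hC.
exists (Num.max 1 (fine (ereal_sup [set h s | s in P]))).
  by rewrite lt_max ltr01.
move=> s Ps; have hs : (h s <= ereal_sup [set h s | s in P])%E.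
  by apply: ereal_sup_ubound; exists s.
rewrite (le_trans hs)// EFin_max le_max.
by move: supy; case: (ereal_sup _) => [r| |]//= _; rewrite ?lexx ?orbT// leNye.
Qed.

Section weakL_theory.
Local Open Scope ereal_scope.
Context {R : realType} {d : measure_display} {T : measurableType d}.
Context {mu : {measure set T -> \bar R}} {K : scalar_kind}.
Implicit Types (f : T -> scalar_type R K) (s t p : R).

Local Notation leb := (@lebesgue_measure R).
Local Notation lam := (distribution_function mu).
Local Notation rear := (rearrangement mu).
Local Notation mrear := (maximal_rearrangement mu).

Lemma maximal_rearrangement_ge0 f t : (0 < t)%R -> 0 <= mrear f t.
Proof.
move=> t0; rewrite mule_ge0// ?lee_fin ?invr_ge0 ?(ltW t0)//.
by apply: integral_ge0 => s _; exact: rearrangement_ge0.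
Qed.

Lemma integral_rearrangementE f t : (0 < t)%R ->
  \int[leb]_(s in `]0%R, t[) rear f s = t%:E * mrear f t.
Proof. by move=> t0; rewrite muleA -EFinM divff ?gt_eqF// mul1e. Qed.

(** On (s, t) the rearrangement is at least its value at [t]. *)
Lemma integral_rearrangement_ge f s t : (0 <= s)%R -> (s < t)%R ->
  \int[leb]_(u in `]0%R, s[) rear f u + (t - s)%:E * rear f t <=
  \int[leb]_(u in `]0%R, t[) rear f u.
Proof.
move=> s0 st.
rewrite (@integral_itv_bndo_bndc _ (BRight 0%R) s); last first.
  by apply: measurable_funTS; exact: measurable_rearrangement.
rewrite (_ : `]0%R, t[%classic = `]0%R, s] `|` `]s, t[); last first.
  by rewrite -itv_bndbnd_setU// ?bnd_simp.
rewrite ge0_integral_setU//=; last 3 first.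
- by apply: measurable_funTS; exact: measurable_rearrangement.
- by move=> u _; exact: rearrangement_ge0.
- apply/disj_setPLR => u /=; rewrite !in_itv/= => /andP[_ us].
  by apply/negP; rewrite negb_and -leNgt us.
rewrite leeD2l//.
have -> : (t - s)%:E * rear f t = \int[leb]_(u in `]s, t[) rear f t.
  by rewrite integral_cst//= lebesgue_measure_itv/= lte_fin st muleC EFinB.
apply: ge0_le_integral => //=.
- by move=> u _; exact: rearrangement_ge0.
- by apply: measurable_funTS; exact: measurable_rearrangement.
by move=> u; rewrite in_itv/= => /andP[_ /ltW ut]; exact: rearrangement_nonincreasing.
Qed.

Lemma rearrangement_le_maximal f t : (0 < t)%R -> rear f t <= mrear f t.
Proof.
move=> t0; rewrite lee_pdivlMl//.
have := @integral_rearrangement_ge f 0%R t (lexx _) t0.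
by rewrite set_itvoo0 integral_set0 add0e subr0.
Qed.

Lemma maximal_rearrangement_dyadic f t : (0 < t)%R ->
  mrear f t + rear f (2 * t)%R <= 2%:E * mrear f (2 * t)%R.
Proof.
move=> t0; have t20 : (0 < 2 * t)%R by rewrite mulr_gt0.
have := @integral_rearrangement_ge f t (2 * t)%R (ltW t0).
rewrite !integral_rearrangementE// (_ : 2 * t - t = t)%R; last by ring.
rewrite -ge0_muleDr ?maximal_rearrangement_ge0 ?rearrangement_ge0//.
rewrite [(2 * t)%:E * _](_ : _ = t%:E * (2%:E * mrear f (2 * t)%R)); last first.
  by rewrite [RHS]muleA -EFinM [(t * 2)%R]mulrC.
by rewrite lee_pmul2l//; apply; rewrite ltr_pMl// ltr1n.
Qed.

Lemma vanishing_maximal_lt f (e : R) : vanishing_at_infinity mu f -> (0 < e)%R ->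
  exists M : R, forall t, (M < t)%R -> mrear f t < e%:E.
Proof.
move=> /fine_cvgP[ffin /cvgr0Pnorm_lt f0] e0.
have [M1 [_ HM1]] := ffin; have [M2 [_ HM2]] := f0 e e0.
exists (Num.max M1 M2) => t; rewrite gt_max => /andP[/HM1 tfin /HM2 te].
by rewrite -(fineK tfin) lte_fin (le_lt_trans _ te)// ler_norm.
Qed.

Lemma vanishing_maximal_lty f t : vanishing_at_infinity mu f -> (0 < t)%R ->
  mrear f t < +oo.
Proof.
move=> vf t0; have [M HM] := vanishing_maximal_lt vf ltr01.
pose u := (Num.max t M + 1)%R.
have tu : (t < u)%R by rewrite ltr_pwDr// le_max lexx.
have Mu : (M < u)%R by rewrite ltr_pwDr// le_max lexx orbT.
have u0 : (0 < u)%R := lt_trans t0 tu.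
have Iu : \int[leb]_(s in `]0%R, u[) rear f s < +oo.
  rewrite integral_rearrangementE// lte_mul_pinfty ?lee_fin ?(ltW u0)//.
  by rewrite (lt_trans (HM _ Mu))// ltry.
rewrite /maximal_rearrangement lte_mul_pinfty// ?lee_fin ?invr_ge0 ?(ltW t0)//.
apply: le_lt_trans Iu; apply: le_trans _ (integral_rearrangement_ge f (ltW t0) tu).
by rewrite leeDl// mule_ge0 ?rearrangement_ge0// lee_fin subr_ge0 ltW.
Qed.

Lemma vanishing_maximal_fin_num f t : vanishing_at_infinity mu f -> (0 < t)%R ->
  mrear f t \is a fin_num.
Proof.
move=> vf t0; rewrite ge0_fin_numE ?maximal_rearrangement_ge0//.
exact: vanishing_maximal_lty.
Qed.

Lemma vanishing_rearrangement_fin_num f t : vanishing_at_infinity mu f ->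
  (0 < t)%R -> rear f t \is a fin_num.
Proof.
move=> vf t0; rewrite ge0_fin_numE ?rearrangement_ge0//.
by rewrite (le_lt_trans (rearrangement_le_maximal _ t0))// vanishing_maximal_lty.
Qed.

(** If lam s were infinite, f* and hence f** would be at least [s] everywhere. *)
Lemma vanishing_distribution_lty f s : measurable_scalar f ->
  vanishing_at_infinity mu f -> (0 < s)%R -> lam f s < +oo.
Proof.
move=> mf vf s0; have [M HM] := vanishing_maximal_lt vf s0.
pose u := (Num.max 1 M + 1)%R.
have u0 : (0 < u)%R by rewrite addr_gt0// lt_max ltr01.
have Mu : (M < u)%R by rewrite ltr_pwDr// le_max lexx orbT.
apply: le_lt_trans (ltry u); rewrite -rearrangement_leE ?(ltW s0)//.
by rewrite (le_trans (rearrangement_le_maximal _ u0))// ltW// HM.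
Qed.

(** A weak-type bound on f* is a bound by a power on the distribution
    function. *)
Lemma weakL_distribution_le f p C s : (0 < p)%R -> (0 < C)%R ->
  measurable_scalar f ->
  (forall t, (0 < t)%R -> rear f t * (t `^ p^-1)%:E <= C%:E) ->
  (0 < s)%R -> lam f s <= (C `^ p * s `^ (- p))%:E.
Proof.
move=> p0 C0 mf hC s0; have Cs0 : (0 < C / s)%R by rewrite divr_gt0.
have -> : (C `^ p * s `^ (- p) = (C / s) `^ p)%R.
  by rewrite powRM ?invr_ge0 ?(ltW C0) ?(ltW s0)// powRVl ?(ltW s0)// powRN.
rewrite -rearrangement_leE ?(ltW s0)//.
have := hC _ (powR_gt0 p Cs0).
rewrite -powRrM divff ?gt_eqF// powRr1 ?(ltW Cs0)// -lee_pdivlMr//.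
by rewrite -EFinM invf_div mulrCA divff ?gt_eqF// mulr1.
Qed.

Lemma weakL_norm_star_norm f p : (1 < p)%R -> measurable_scalar f ->
  weakL_norm_star mu p f < +oo -> weakL_norm mu p f < +oo.
Proof.
move=> p1 mf /ereal_sup_ltyP[C C0 hC]; have p0 : (0 < p)%R := lt_trans ltr01 p1.
have p10 : (0 < p - 1)%R by rewrite subr_gt0.
apply/ereal_sup_ltyP; exists (C * (p / (p - 1)))%R.
  by rewrite mulr_gt0// divr_gt0.
move=> t /= t0; set x := (t `^ p^-1)%R.
have x0 : (0 < x)%R by exact: powR_gt0.
have xp : (x `^ p = t)%R by rewrite -powRrM mulVf ?gt_eqF// powRr1// ltW.
pose b := (C / x)%R; have b0 : (0 < b)%R by rewrite divr_gt0.
rewrite -lee_pdivlMr// lee_pdivrMl//.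
apply: le_trans (integral_rearrangement_le mf (ltW t0) (ltW b0)) _.
(* The level [b] = C t^(-1/p) balances the two terms of the area inequality:
   both are multiples of t^(1 - 1/p). *)
have Ib : \int[leb]_(s in `]b, +oo[) lam f s <=
    (C `^ p * (b `^ (1 - p) / (p - 1)))%:E.
  rewrite EFinM -integral_powR_tail// -ge0_integralZl_EFin ?powR_ge0//; last 2 first.
  - by move=> s _; rewrite lee_fin powR_ge0.
  - by apply/measurable_EFinP; apply: measurable_funTS; exact: measurable_powR.
  apply: ge0_le_integral => //=.
  - by apply: measurable_funTS; exact: measurable_distribution.
  - apply: measurable_funeM.
    by apply/measurable_EFinP; apply: measurable_funTS; exact: measurable_powR.
  - move=> s; rewrite in_itv/= andbT => bs; rewrite -EFinM.
    by apply: weakL_distribution_le => //; exact: lt_trans bs.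
apply: le_trans (leeD2l _ Ib) _.
rewrite -EFinD -!EFinM lee_fin.
have -> : (C `^ p * (b `^ (1 - p) / (p - 1)) = t * b / (p - 1))%R.
  rewrite powRB ?(gt_eqF b0) ?implybT// powRr1 ?(ltW b0)//.
  rewrite /b powRM ?invr_ge0 ?(ltW C0) ?(ltW x0)//.
  rewrite powRVl ?(ltW x0)// xp.
  have Cp : (C `^ p)%R != 0%R by rewrite gt_eqF// powR_gt0.
  by field; rewrite Cp !gt_eqF.
rewrite le_eqVlt; apply/orP; left; apply/eqP; rewrite /b.
by field; rewrite !gt_eqF.
Qed.

Lemma le_weakL_norm_star f p : weakL_norm_star mu p f <= weakL_norm mu p f.
Proof.
apply: ge_ereal_sup => _ [s /= s0 <-]; apply: le_ereal_sup_tmp.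
exists (mrear f s * (s `^ p^-1)%:E); first by exists s.
by rewrite lee_wpmul2r ?lee_fin ?powR_ge0// rearrangement_le_maximal.
Qed.

Lemma le_weakL_norm_sharp f p : weakL_norm_sharp mu p f <= weakL_norm mu p f.
Proof.
apply: ge_ereal_sup => _ [s /= s0 <-]; apply: le_ereal_sup_tmp.
exists (mrear f s * (s `^ p^-1)%:E); first by exists s.
rewrite lee_wpmul2r ?lee_fin ?powR_ge0//.
have := @rearrangement_ge0 _ _ _ mu _ f s.
case: (rear f s) => [r| |]//; last by rewrite addeNy leNye.
by rewrite lee_fin => r0; rewrite leeBlDr// leeDl// lee_fin.
Qed.

Lemma weakL_norm_vanishing f p : (0 < p)%R ->
  weakL_norm mu p f < +oo -> vanishing_at_infinity mu f.
Proof.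
move=> p0 /ereal_sup_ltyP[C C0 hC].
apply: (@squeeze_cvge _ _ _ _ (cst 0) _ (fun t => (C * t `^ (- p^-1))%:E)).
- near=> t; have t0 : (0 < t)%R by near: t; exact: nbhs_pinfty_gt.
  rewrite maximal_rearrangement_ge0//= powRN EFinM lee_pdivlMr ?powR_gt0//.
  exact: hC.
- exact: cvg_cst.
- apply: cvg_EFin; first exact: nearW.
  rewrite -[X in _ --> X](mulr0 C); apply: cvgM; first exact: cvg_cst.
  by apply: powRN_cvgy0; rewrite invr_gt0.
Unshelve. all: by end_near. Qed.

(** Here the vanishing of f** at infinity is essential: on a space of
    infinite measure, a constant function has f** = f*. *)
Lemma weakL_norm_sharp_norm f p : (0 < p)%R -> vanishing_at_infinity mu f ->
  weakL_norm_sharp mu p f < +oo -> weakL_norm mu p f < +oo.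
Proof.
move=> p0 vf /ereal_sup_ltyP[C C0 hC].
pose k := (2 `^ (- p^-1) : R)%R.
have k0 : (0 < k)%R by exact: powR_gt0.
have k1 : (k < 1)%R.
  rewrite /k powRN invf_lt1 ?powR_gt0//.
  have := @gt0_ltr_powR R p^-1%R; rewrite invr_gt0 => /(_ p0 1 2)%R.
  by rewrite powR1 !nnegrE ler01 ler0n ltr1n; exact.
(* [C'] is the sum of the geometric series C k^n over n >= 1. *)
pose C' := (C * k / (1 - k))%R.
have C'0 : (0 < C')%R by rewrite divr_gt0 ?mulr_gt0// subr_gt0.
have double t : (0 < t)%R ->
    mrear f t <= mrear f (2 * t)%R + (C * k * t `^ (- p^-1))%:E.
  move=> t0; have t20 : (0 < 2 * t)%R by rewrite mulr_gt0.
  have := maximal_rearrangement_dyadic f t0; have := hC _ t20.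
  rewrite -lee_pdivlMr ?powR_gt0// -powRN powRM ?(ltW t0)//.
  rewrite -(fineK (vanishing_maximal_fin_num vf t0)).
  rewrite -(fineK (vanishing_maximal_fin_num vf t20)).
  rewrite -(fineK (vanishing_rearrangement_fin_num vf t20)).
  rewrite -EFinB -!EFinM -!EFinD !lee_fin -/k => H1 H2; lra.
have iter n t : (0 < t)%R ->
    mrear f t <= mrear f (2 ^+ n * t)%R + (C' * t `^ (- p^-1))%:E.
  elim: n t => [|n IH] t t0.
    by rewrite expr0 mul1r leeDl// lee_fin mulr_ge0 ?powR_ge0// ltW.
  have t20 : (0 < 2 * t)%R by rewrite mulr_gt0.
  apply: le_trans (double _ t0) _.
  apply: le_trans (leeD2r _ (IH _ t20)) _.
  rewrite mulrA -exprSr -addeA leeD2l// -EFinD lee_fin powRM ?(ltW t0)// -/k.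
  rewrite le_eqVlt; apply/orP; left; apply/eqP; rewrite /C'.
  by field; rewrite subr_eq0 gt_eqF.
apply/ereal_sup_ltyP; exists C' => // t /= t0.
rewrite -lee_pdivlMr ?powR_gt0// -powRN -EFinM; apply/lee_addgt0Pr => e e0.
have [M HM] := vanishing_maximal_lt vf e0.
have [n Hn] : exists n, (M < 2 ^+ n * t)%R.
  exists (Num.bound `|M / t|%R); rewrite -ltr_pdivrMr//.
  apply: lt_le_trans (_ : ((Num.bound `|M / t|%R)%:R <= _)%R).
    by apply: le_lt_trans (ler_norm _) _; exact: archi_boundP (normr_ge0 _).
  by rewrite -natrX ler_nat ltnW// ltn_expl.
by rewrite addeC (le_trans (iter n _ t0))// leeD2r// ltW// HM.
Qed.

Lemma vanishing_L1loc f : ae_finite_functions mu f ->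
  vanishing_at_infinity mu f -> L1loc mu f.
Proof.
move=> aef vf; split => // A mA muA; have [mf _] := aef.
apply: le_lt_trans (integral_modulus_le mf mA muA) _.
have [->|A0] := eqVneq (fine (mu A)) 0%R; first by rewrite set_itvoo0 integral_set0.
have A0' : (0 < fine (mu A))%R by rewrite lt0r A0 fine_ge0.
rewrite integral_rearrangementE// lte_mul_pinfty ?lee_fin ?(ltW A0')//.
exact: vanishing_maximal_lty.
Qed.

Lemma weakL_norm_sharp_sharp2 f p : measurable_scalar f ->
  vanishing_at_infinity mu f ->
  weakL_norm_sharp mu p f < +oo -> weakL_norm_sharp2 mu p f < +oo.
Proof.
move=> mf vf /ereal_sup_ltyP[C C0 hC]; apply/ereal_sup_ltyP; exists C => // s /= s0.
rewrite /tail_quotient; case: ifPn => [_|ls0]; first by rewrite lee_fin ltW.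
have lfin : lam f s \is a fin_num.
  by rewrite ge0_fin_numE ?distribution_ge0// vanishing_distribution_lty.
pose t := fine (lam f s); have lt : lam f s = t%:E by rewrite fineK.
have t0 : (0 < t)%R.
  by rewrite -lte_fin -lt lt0e ls0 distribution_ge0.
rewrite lt poweR_EFin inver gt_eqF ?powR_gt0// lee_pdivrMl ?powR_gt0//.
have := integral_rearrangement_eq mf (ltW s0) lt.
have rs : rear f t <= s%:E by rewrite rearrangement_leE ?(ltW s0)// lt.
have := hC _ t0; rewrite integral_rearrangementE//; move: rs.
rewrite -(fineK (vanishing_maximal_fin_num vf t0)).
rewrite -(fineK (vanishing_rearrangement_fin_num vf t0)).
have : 0 <= \int[leb]_(u in `]s, +oo[) lam f u.
  by apply: integral_ge0 => u _; exact: distribution_ge0.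
case: (\int[leb]_(u in `]s, +oo[) lam f u) => [I| |]//= _.
rewrite -EFinB -!EFinM -!EFinD !lee_fin => rs.
rewrite -ler_pdivlMr ?powR_gt0// => H1 [H2].
rewrite powRB ?(gt_eqF t0) ?implybT// powRr1 ?(ltW t0)//.
have : (t * (fine (mrear f t) - s) <= t * (C / t `^ p^-1))%R.
  by rewrite ler_pM2l// (le_trans _ H1)// lerD2l lerN2.
rewrite mulrA [(t * C)%R]mulrC mulrAC mulrC => H3; lra.
Qed.

(** A bound on the quotient of (d) at [b], stated without division and with any
    upper bound [t] of lam b; it includes the case lam b = 0. *)
Lemma tail_quotient_le f p C b t : (1 < p)%R -> measurable_scalar f ->
  (0 < C)%R -> (0 < b)%R -> tail_quotient mu p f b <= C%:E ->
  (0 <= t)%R -> lam f b <= t%:E ->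
  \int[leb]_(s in `]b, +oo[) lam f s <= (C * t `^ (1 - p^-1))%:E.
Proof.
move=> p1 mf C0 b0 + t0 lbt.
have q0 : (0 <= 1 - p^-1)%R.
  by rewrite subr_ge0 invf_le1 ?(ltW p1)// (lt_trans ltr01).
rewrite /tail_quotient; case: ifPn => [/eqP lb0 _|lb0].
  rewrite integral0_eq ?lee_fin ?mulr_ge0 ?powR_ge0 ?(ltW C0)// => s /=.
  rewrite in_itv/= andbT => /ltW bs; apply/le_anti; rewrite distribution_ge0 andbT.
  by rewrite -lb0 distribution_nonincreasing.
have lfin : lam f b \is a fin_num.
  by rewrite ge0_fin_numE ?distribution_ge0// (le_lt_trans lbt)// ltry.
pose r := fine (lam f b); have lr : lam f b = r%:E by rewrite fineK.
have r0 : (0 < r)%R by rewrite -lte_fin -lr lt0e lb0 distribution_ge0.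
rewrite lr poweR_EFin inver gt_eqF ?powR_gt0// lee_pdivrMl ?powR_gt0//.
move=> /le_trans; apply; rewrite -EFinM lee_fin mulrC ler_pM2l//.
by apply: ge0_ler_powR; rewrite ?nnegrE ?(ltW r0)// -lee_fin -lr.
Qed.

Lemma weakL_norm_sharp2_sharp f p : (1 < p)%R -> measurable_scalar f ->
  vanishing_at_infinity mu f ->
  weakL_norm_sharp2 mu p f < +oo -> weakL_norm_sharp mu p f < +oo.
Proof.
move=> p1 mf vf /ereal_sup_ltyP[C C0 hC]; apply/ereal_sup_ltyP; exists C => // t /= t0.
have afin := vanishing_rearrangement_fin_num vf t0.
have Afin := vanishing_maximal_fin_num vf t0.
rewrite -lee_pdivlMr ?powR_gt0// leeBlDr//.
apply/lee_addgt0Pr => e e0.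
(* The level is f* t + e and not f* t because the quotient of (d) is taken at
   positive levels only, and f* t may be 0. *)
pose b := (fine (rear f t) + e)%R.
have b0 : (0 < b)%R by rewrite ltr_wpDl// fine_ge0// rearrangement_ge0.
have lbt : lam f b <= t%:E.
  by rewrite -rearrangement_leE ?(ltW b0)// EFinD fineK// leeDl// lee_fin ltW.
have Ib := tail_quotient_le p1 mf C0 b0 (hC _ b0) (ltW t0) lbt.
have := @integral_rearrangement_le _ _ _ mu _ _ _ _ mf (ltW t0) (ltW b0).
move=> /le_trans /(_ (leeD2l _ Ib)).
rewrite integral_rearrangementE// -(fineK Afin) -(fineK afin).
rewrite -!EFinM -!EFinD !lee_fin powRB ?(gt_eqF t0) ?implybT// powRr1 ?(ltW t0)//.
rewrite (_ : t * b + _ = t * (C / t `^ p^-1 + fine (rear f t) + e))%R; last first.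
  by rewrite /b; ring.
by rewrite ler_pM2l.
Qed.

End weakL_theory.

Unset Implicit Arguments.

Theorem theorem4 (R : realType) (d : measure_display) (T : measurableType d)
    (mu : {measure set T -> \bar R}) (K : scalar_kind) (p : R) (hp : 1 < p) :
  [/\ weakL mu K p = weakL_maximal mu K p,
      weakL_maximal mu K p = weakL_sharp mu K p &
      weakL_sharp mu K p = weakL_sharp2 mu K p].
Proof.
have p0 : 0 < p by exact: lt_trans hp.
split; apply/seteqP; split => f.
- move=> [L1f starf]; split => //; apply: weakL_norm_star_norm => //.
  by case: L1f => -[].
- by move=> [L1f normf]; split => //; exact: le_lt_trans (le_weakL_norm_star _ _) normf.
- move=> [[aef _] normf]; split => //; first exact: weakL_norm_vanishing normf.
  exact: le_lt_trans (le_weakL_norm_sharp _ _) normf.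
- move=> [aef vf sharpf]; split; first exact: vanishing_L1loc.
  exact: weakL_norm_sharp_norm.
- move=> [aef vf sharpf]; split => //; apply: weakL_norm_sharp_sharp2 => //.
  by case: aef.
- move=> [aef vf sharpf]; split => //; apply: weakL_norm_sharp2_sharp => //.
  by case: aef.
Qed.
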